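(* Let $D$ be a diagram of a knot $K$ with $c\ge 1$ crossings, equipped with a checkerboard coloring having $s$ shaded regions. Choose a strand $\alpha_1$ of $D$ partially bounding a shaded region $R_1$; number the strands so that $\alpha_1$ is the first strand, and number the shaded regions so that $R_1$ is the first region. Let $\tilde C$ and $\tilde G$ be the resulting pre-coloring matrix and pre-Goeritz matrix of $D$. Let $C$ (respectively $G$) be the coloring matrix (respectively Goeritz matrix) obtained by deleting the first row and the first column of $\tilde C$ (respectively $\tilde G$). Then for every $n\in\mathbb{N}$, $n\geq 1$, there are bijections among the following sets, where all linear systems are considered over $\mathbb{Z}/n\mathbb{Z}$: (i) the set of non-trivial solutions $\tilde v\in(\mathbb{Z}/n\mathbb{Z})^{c}$ of $\tilde C\tilde v=\vec 0$ with first entry $0$; (ii) the set of non-trivial solutions $v\in(\mathbb{Z}/n\mathbb{Z})^{c-1}$ of $Cv=\vec 0$; (iii) the set of non-trivial solutions $w\in(\mathbb{Z}/n\mathbb{Z})^{s-1}$ of $Gw=\vec 0$; (iv) the set of non-trivial solutions $\tilde w\in(\mathbb{Z}/n\mathbb{Z})^{s}$ of $\tilde G\tilde w=\vec 0$ with first entry $0$. Moreover, the bijection between (ii) and (iii), extended by sending $\vec 0$ to $\vec 0$, is linear, so that it is an isomorphism of $\mathbb{Z}/n\mathbb{Z}$-modules between the null spaces $\mathrm{Nul}(C)$ and $\mathrm{Nul}(G)$ over $\mathbb{Z}/n\mathbb{Z}$. In particular, for prime $n$, the mod $n$ nullities (dimensions of the null spaces over $\mathbb{Z}/n\mathbb{Z}$)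 of $C$ and $G$ are equal.
   Context: A knot is a smooth embedding of $S^1$ in $\mathbb{R}^3$. A knot diagram $D$ is a generic planar projection of it (only transverse double points) with over/under information at each crossing. The strands of $D$ are the maximal arcs running from one undercrossing to the next; a knot diagram with $c\ge1$ crossings has exactly $c$ strands. The regions of $D$ are the connected components of the complement of the projection in the plane; a checkerboard coloring shades some of the regions so that, of any two regions adjacent along an edge of the projection, exactly one is shaded. Pre-coloring matrix: assign a variable $x_i$ to each strand. For each crossing with overstrand $x_j$ and understrands $x_i,x_k$, write the equation $x_i+x_k-2x_j=0$ (coefficients are added if some of these strands coincide; the equation may be written with an overall sign change). The $c\times c$ integer coefficient matrix of this system, with columns indexed by strands and rows by crossings (in any order of the crossings), is the pre-coloring matrix $\tilde C$. A coloring matrix is obtained from $\tilde C$ by deleting one row and one column. Pre-Goeritz matrix: each crossing $x$ has a sign $\eta(x)\in\{\pm1\}$: $\eta(x)=+1$ if rotating the overstrand at $x$ clockwise until it meets the understrand sweeps out the shaded corners, and $\eta(x)=-1$ otherwise. (Using the opposite convention throughout replaces $\tilde G$ by $-\tilde G$.) If the shaded regions are $R_1,\dots,R_s$, then $\tilde G$ is the $s\times s$ integer matrix with $\tilde G_{i,j}=\sum\eta(x)$ for $i\ne j$, the sum being over all crossings $x$ at which $R_i$ and $R_j$ come together, and $\tilde G_{i,i}=-\sum_{j\neq i}\tilde G_{i,j}$. A Goeritz matrix is obtained from $\tilde G$ by deleting one row and one column. A solution of a homogeneous linear system is non-trivial if it is not the zero vector. *)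

(* Defs.v *)
From HB Require Import structures.
From mathcomp Require Import all_boot all_order all_fingroup all_algebra.

Set Implicit Arguments.
Unset Strict Implicit.
Unset Printing Implicit Defensive.

Import GRing.Theory.
Local Open Scope ring_scope.

(* Z/nZ for every n >= 1, the zero ring Z/1Z included (this is why the        *)
(* library's 'Z_n, which is Z/2Z at n = 1, is not used): the integers below n *)
(* with the modular operations of zmodp.                                      *)
Definition Zmod (n : nat) := 'I_n.-1.+1.

HB.instance Definition _ (n : nat) := Finite.on (Zmod n).
HB.instance Definition _ (n : nat) := GRing.Zmodule.on (Zmod n).
HB.instance Definition _ (n : nat) :=
  GRing.Zmodule_isComPzRing.Build (Zmod n)
    (@Zp_mulA _) (@Zp_mulC _) (@Zp_mul1z _) (@Zp_mul_addl _).

(* A diagram with c >= 1 crossings is recorded, up to isotopy, as a           *)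
(* combinatorial map.  The four half-edges leaving crossing x are the darts   *)
(* (x, 0), (x, 1), (x, 2), (x, 3), in counterclockwise order; (x, 0) and      *)
(* (x, 2) belong to the understrand, (x, 1) and (x, 3) to the overstrand.     *)
(* A dart d also stands for the corner at its crossing lying between d and    *)
(* its counterclockwise successor, that is, just to the left of d when        *)
(* leaving the crossing along d.                                              *)
Definition dart (c : nat) : predArgType := ('I_c * 'I_4)%type.

Definition prev_dart c (d : dart c) : dart c := (d.1, d.2 - 1).

Definition opposite c (d : dart c) : dart c := (d.1, d.2 + 2%:R).

Definition over c (d : dart c) : bool := odd d.2.

Section Regions.
Variables (c : nat) (glue : dart c -> dart c).

(* Following the edge of d with its left side on the left, one arrives at the *)
(* next crossing along glue d, in the corner preceding glue d.                *)
Definition next_corner (d : dart c) : dart c := prev_dart (glue d).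

Definition region_of (d : dart c) : {set dart c} :=
  [set d' | fconnect next_corner d d'].

Definition region_set : {set {set dart c}} := [set region_of d | d : dart c].

End Regions.

(* glue d is the dart at the other end of the edge containing d.  The last    *)
(* two fields say that going straight on at every crossing traverses the      *)
(* whole diagram (so there is a single component, and the projection is       *)
(* connected), and that V - E + F = 2, where V = c and E = 2c: the projection *)
(* is drawn on the sphere, i.e., in the plane together with the point at      *)
(* infinity, which lies inside one of the regions.                            *)
Record knot_diagram (c : nat) := KnotDiagram {
  glue : dart c -> dart c;
  glueK : involutive glue;
  glue_neq : forall d, glue d != d;
  one_component : forall d d',
    connect [rel x y | (y == glue x) || (y == opposite x)] d d';
  planar : #|region_set glue| = (c + 2)%N }.

Section Diagram.
Variables (c : nat) (D : knot_diagram c).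

Definition region (d : dart c) : {set dart c} := region_of (glue D) d.

Definition regions : {set {set dart c}} := region_set (glue D).

(* Strands, as sets of darts: a strand continues along edges, and through a   *)
(* crossing exactly when it is the overstrand there.                          *)
Definition strand (d : dart c) : {set dart c} :=
  [set d' | connect
     [rel x y | (y == glue D x) || (over x && (y == opposite x))] d d'].

Definition strands : {set {set dart c}} := [set strand d | d : dart c].

(* The two sides of the edge of d are the corners d and prev_dart d.          *)
Definition checkerboard (S : {set {set dart c}}) : Prop :=
  S \subset regions /\
  forall d : dart c, (region d \in S) (+) (region (prev_dart d) \in S).

(* Every edge of the strand a has both its darts in a, so it suffices to      *)
(* look at the left sides of the darts.                                       *)
Definition bounds (a R : {set dart c}) : Prop :=
  exists d : dart c, d \in a /\ d \in R.

Definition incident (R : {set dart c}) (x : 'I_c) : bool :=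
  [exists k : 'I_4, (x, k) \in R].

(* Rotated clockwise until it meets the understrand, the overstrand           *)
(* {(x, 1), (x, 3)} sweeps out the opposite corners (x, 0) and (x, 2); in a   *)
(* checkerboard coloring both are shaded or neither is.                       *)
Definition eta (S : {set {set dart c}}) (x : 'I_c) : int :=
  if (region (x, 0) \in S) && (region (x, 2%:R) \in S) then 1 else -1.

(* Row i is the equation of the crossing chi i, up to the sign (-1)^(neg i);  *)
(* alpha lists the strands.                                                   *)
Definition precoloring_mx (alpha : 'I_c -> {set dart c}) (chi : 'S_c)
    (neg : 'I_c -> bool) : 'M[int]_c :=
  \matrix_(i, j) ((-1) ^+ neg i *
    (((chi i, 0) \in alpha j)%:R + ((chi i, 2%:R) \in alpha j)%:R
      - 2%:R * ((chi i, 1) \in alpha j)%:R)).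

Definition pregoeritz_offdiag (S : {set {set dart c}})
    (R R' : {set dart c}) : int :=
  \sum_(x < c | incident R x && incident R' x) eta S x.

Definition pregoeritz_mx (S : {set {set dart c}}) (s : nat)
    (R : 'I_s -> {set dart c}) : 'M[int]_s :=
  \matrix_(i, j)
    if i == j then - \sum_(k < s | k != i) pregoeritz_offdiag S (R i) (R k)
    else pregoeritz_offdiag S (R i) (R j).

End Diagram.

Definition numbering (T : finType) (k : nat) (f : 'I_k -> T) (A : {set T}) :
  Prop := injective f /\ [set f i | i : 'I_k] = A.

Definition delete_first (k : nat) (A : 'M[int]_k.+1) : 'M[int]_k :=
  row' ord0 (col' ord0 A).

Definition nul (n k : nat) (A : 'M[int]_k) : {set 'cV[Zmod n]_k} :=
  [set v | map_mx intr A *m v == 0].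

Definition nontrivial_nul (n k : nat) (A : 'M[int]_k) : {set 'cV[Zmod n]_k} :=
  [set v in nul n A | v != 0].

Definition nontrivial_nul0 (n k : nat) (A : 'M[int]_k.+1) :
    {set 'cV[Zmod n]_k.+1} :=
  [set v in nontrivial_nul n A | v ord0 ord0 == 0].

Definition bijects (T U : finType) (f : T -> U) (A : {set T}) (B : {set U}) :
  Prop := {in A &, injective f} /\ f @: A = B.

Definition linear_on (R : pzRingType) (V W : lmodType R) (A : pred V)
    (g : V -> W) : Prop :=
  {in A &, {morph g : u v / u + v}} /\
  forall a : R, {in A, {morph g : u / a *: u}}.

Definition nullity (F : fieldType) (k : nat) (A : 'M[int]_k) : nat :=
  \dim (lker (linfun (mulmx (map_mx intr A : 'M[F]_k) : 'cV_k -> 'cV_k))).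

(* Main.v *)
Require Import Defs.
From mathcomp Require Import all_boot all_order all_fingroup all_algebra all_field.
From mathcomp Require Import ring zify.

(** Both null spaces are identified with a module of labellings of the regions
    of the diagram.  Call a labelling [r] of the regions a Dehn labelling if, at
    every crossing, the labels on the two sides of one half of the overstrand
    have the same sum as those on the two sides of the other half.

    Giving each edge the sum of the labels on its two sides turns a Dehn
    labelling into a solution of the coloring equations.  Conversely a coloring
    is an edge labelling with vanishing alternating sum at each crossing, and
    planarity says that each of those comes from a region labelling
    ([side_sum_onto]).  The latter is proved by counting over a finite ring
    with [q] elements: with [N] crossings there are [q ^ (2 N)] edge labellings
    at most, their alternating sums take [q ^ (N - 1)] values at least since
    the diagram is connected, and the region labellings have [q ^ (N + 1)]
    images at least, since there are [N + 2] regions and only a one-parameter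
    family of region labellings has all its sums zero.

    Restricting a Dehn labelling to the shaded regions yields a solution of the
    Goeritz equations: at a shaded corner, the difference of the two shaded
    labels at the crossing is, up to sign, the difference of the two unshaded
    ones, and these differences telescope around a shaded region.  Conversely,
    the Goeritz equations allow one to integrate the differences around each shaded
    region, which gives an edge labelling to which [side_sum_onto] applies
    ([dehn_of_goeritz]).

    Let [d1] be a dart of the first strand with the first region on its left.
    Dehn labellings that vanish on both sides of [d1] correspond bijectively
    to the colorings, and to the Goeritz solutions, with first entry 0
    ([strand_values_bij], [region_values_bij]).  Finally deleting the first row
    loses nothing: a combination of all rows with coefficients 1 and -1
    vanishes ([precoloring_col_sum], [pregoeritz_col_sum]). *)

Set Implicit Arguments.
Unset Strict Implicit.
Unset Printing Implicit Defensive.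

Import GRing.Theory.
Local Open Scope ring_scope.

(* The imported libraries have another constant of this name. *)
Local Notation over := Defs.over.

(** * Counting in finite modules *)

Lemma card_additive_image (U V : finZmodType) (A : {set U}) (f : U -> V) :
    zmod_closed A -> {morph f : x y / x - y} ->
  #|A| = (#|[set u in A | f u == 0%R]| * #|f @: A|)%N.
Proof.
move=> [A0 AB] fB; have f0: f 0 = 0 by rewrite -[in LHS](subrr 0) fB subrr.
have fN x : f (- x) = - f x by rewrite -sub0r fB f0 sub0r.
have AN x : x \in A -> - x \in A by rewrite -sub0r; apply: AB.
rewrite mulnC -[LHS]sum1_card (partition_big_imset f) /= -sum_nat_const.
apply: eq_bigr => _ /imsetP[u Au ->]; rewrite sum1_card.
rewrite -[in RHS](card_imset _ (addrI u)); apply: eq_card => v; rewrite [LHS]unfold_in /=.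
apply/andP/imsetP => [[Av /eqP fv] | [w]].
  exists (v - u); last by rewrite addrC subrK.
  by rewrite inE AB // fB fv subrr eqxx.
rewrite inE => /andP[Aw /eqP fw] ->; split.
  by rewrite -[w]opprK AB ?AN.
by rewrite -[w]opprK fB fN fw oppr0 subr0.
Qed.

Lemma zmod_closed_imset (U V : finZmodType) (A : {set U}) (f : U -> V) :
  zmod_closed A -> {morph f : x y / x - y} -> zmod_closed (f @: A).
Proof.
move=> [A0 AB] fB; split=> [|_ _ /imsetP[x Ax ->] /imsetP[y Ay ->]].
  by rewrite -[0](subrr (f 0)) -fB imset_f // AB.
by rewrite -fB imset_f // AB.
Qed.

(** The numerical content of the count in [side_sum_onto], with [Q] for
    [q ^ N]; [z] is the order of the group of edge labellings with vanishing
    alternating sums, [b] that of the image of the region labellings. *)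
Lemma card_estimate (q Q z i e k b : nat) :
    (0 < q)%N -> (0 < Q)%N -> e = (z * i)%N -> (e <= Q * Q)%N ->
    (Q <= q * i)%N -> (Q * (q * q) <= k * b)%N -> (k <= q)%N ->
  (z <= b)%N.
Proof.
move=> q0 Q0 -> leQ leqi leqb leq.
have lez : (z <= q * Q)%N.
  by rewrite -(leq_pmul2r Q0) (@leq_trans (z * (q * i))) ?leq_mul2l ?leqi ?orbT //; nia.
by apply: leq_trans lez _; rewrite -(leq_pmul2l q0) (leq_trans _ (leq_mul leq (leqnn b))) //; nia.
Qed.

(** * Darts, crossings and regions *)

Section Darts.
Variables (N : nat) (D : knot_diagram N).
Implicit Types d : dart N.

Lemma opposite_prev d : opposite d = prev_dart (prev_dart d).
Proof. by case: d => x [[|[|[|[|]]]] //= ?]; congr (_, _); apply: val_inj. Qed.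

Lemma prev4 d :
  prev_dart (prev_dart (prev_dart (prev_dart d))) = d.
Proof. by case: d => x [[|[|[|[|]]]] //= ?]; congr (_, _); apply: val_inj. Qed.

Lemma prev_inj : injective (@prev_dart N).
Proof. by move=> d e de; rewrite -[d]prev4 de prev4. Qed.

Lemma over_prev d : over (prev_dart d) = ~~ over d.
Proof. by case: d => x [[|[|[|[|]]]] //= ?]. Qed.

Lemma oppositeK : involutive (@opposite N).
Proof. by move=> d; rewrite !opposite_prev prev4. Qed.

Lemma over_opposite d : over (opposite d) = over d.
Proof. by rewrite opposite_prev !over_prev negbK. Qed.

Lemma sum_crossing (V : zmodType) (F : dart N -> V) d :
  \sum_(k < 4) F (d.1, k) =
    F d + F (prev_dart d) + F (opposite d) + F (prev_dart (opposite d)).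
Proof.
rewrite (reindex_inj (addIr d.2)) 4!big_ord_recl big_ord0 /= addr0.
rewrite [X in _ + X]addrC [X in _ + (X + _)]addrC !addrA; case: d => x [[|[|[|[|]]]] //= ?];
  by do 3?[congr (_ + _)]; congr (F (_, _)); apply: val_inj.
Qed.

Lemma over_eq d : over d -> d = (d.1, 1) \/ d = opposite (d.1, 1).
Proof.
by case: d => x [[|[|[|[|]]]] //= ?] _; [left | right]; congr (_, _); apply: val_inj.
Qed.

Lemma under_prev (x : 'I_N) : (x, 0) = prev_dart (x, 1) :> dart N.
Proof. by congr (_, _); apply: val_inj. Qed.

Lemma under_prev_opposite (x : 'I_N) :
  (x, 2%:R) = prev_dart (opposite (x, 1)) :> dart N.
Proof. by congr (_, _); apply: val_inj. Qed.

Lemma crossing_darts d d' : d.1 = d'.1 ->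
  [\/ d' = d, d' = prev_dart d, d' = opposite d | d' = prev_dart (opposite d)].
Proof.
case: d d' => x k [y l] /= -> {x}.
have : l - k \in [:: 0; -1; 2%:R; 2%:R - 1] by case: (l - k) => [[|[|[|[|]]]]].
rewrite !inE !subr_eq => /or4P[] /eqP->; [apply: Or41 | apply: Or42 | apply: Or43 | apply: Or44];
  by rewrite /opposite /prev_dart ?add0r //= addrC ?addrA.
Qed.

Lemma next_corner_inj : injective (next_corner (glue D)).
Proof. by move=> d d' /prev_inj /(inv_inj (@glueK _ D)). Qed.

(** The maps [glue D] and [prev_dart] act transitively on the darts. *)
Lemma dart_ind (P : dart N -> Prop) d0 :
    P d0 -> (forall d, P d -> P (glue D d)) ->
    (forall d, P d -> P (prev_dart d)) ->
  forall d, P d.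
Proof.
move=> P0 Pg Pp d; have /connectP[p pth ->] := one_component D d0 d.
elim: p d0 P0 pth => //= e p IHp d0 P0 /andP[de]; apply: IHp.
case/orP: de => /eqP->; first exact: Pg.
by rewrite opposite_prev; do 2!apply: (Pp).
Qed.

Lemma dart_const (T : Type) (m : dart N -> T) :
    (forall d, m (glue D d) = m d) -> (forall d, m (prev_dart d) = m d) ->
  forall d d', m d = m d'.
Proof.
by move=> mg mp d; apply: dart_ind => // d' mdd'; rewrite ?mg ?mp.
Qed.

Lemma mem_region d d' : (d' \in region D d) = (region D d == region D d').
Proof.
have sym := fconnect_sym next_corner_inj.
apply/idP/eqP => [dd' | ->]; last by rewrite inE.
by apply/setP=> e; rewrite !inE; rewrite inE in dd'; apply: same_connect.
Qed.

Lemma region_next d : region D (next_corner (glue D) d) = region D d.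
Proof. by apply/esym/eqP; rewrite -mem_region inE fconnect1. Qed.

Lemma region_const (T : Type) (r : dart N -> T) :
    (forall d, r (next_corner (glue D) d) = r d) ->
  forall d d', region D d = region D d' -> r d = r d'.
Proof.
move=> rP d d' /eqP; rewrite -mem_region inE => /iter_findex <-.
by elim: findex => //= n ->; rewrite rP.
Qed.

Lemma mem_regions d : region D d \in regions D.
Proof. exact: imset_f. Qed.

End Darts.

(** * Edge labellings that come from region labellings *)

Section Coloured.
Variables (N : nat) (D : knot_diagram N) (S : {set {set dart N}}).
Hypothesis chk : checkerboard D S.
Implicit Types d : dart N.

(** The corner [d] lies in a shaded region. *)
Definition shaded_corner d : bool := region D d \in S.
Local Notation shaded := shaded_corner.

Lemma shaded_prev d : shaded (prev_dart d) = ~~ shaded d.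
Proof. by case: chk => _ /(_ d); rewrite /shaded_corner; do 2!case: (_ \in S). Qed.

Lemma shaded_next d : shaded (next_corner (glue D) d) = shaded d.
Proof. by rewrite /shaded_corner region_next. Qed.

Lemma shaded_glue d : shaded (glue D d) = ~~ shaded d.
Proof. by rewrite -[shaded d]shaded_next shaded_prev negbK. Qed.

Lemma shaded_opposite d : shaded (opposite d) = shaded d.
Proof. by rewrite opposite_prev !shaded_prev negbK. Qed.

(** Every edge has exactly one shaded side, hence one shaded dart. *)
Lemma card_shaded : #|[set d | shaded d]| = (2 * N)%N.
Proof.
have: #|[set d | shaded d]| = #|~: [set d | shaded d]|.
  rewrite -(card_imset _ (inv_inj (@glueK _ D))); apply: eq_card => d.
  rewrite !inE; apply/imsetP/idP => [[e] | nd].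
    by rewrite inE => se ->; rewrite shaded_glue se.
  by exists (glue D d); rewrite ?glueK // inE shaded_glue.
have := cardsC [set d | shaded d]; rewrite card_prod !card_ord; lia.
Qed.

Section Potential.
Variable K : finComPzRingType.

Local Notation labelling := 'M[K]_(N, 4).

(** A labelling of the darts, or of the corners, by elements of [K] is kept
    as a matrix, so that labellings form a finite module. *)
Definition label (r : labelling) d : K := r d.1 d.2.

Definition labelling_of (f : dart N -> K) : labelling :=
  \matrix_(x, k) f (x, k).

Lemma labelE f d : label (labelling_of f) d = f d.
Proof. by rewrite /label mxE -surjective_pairing. Qed.

Lemma labelP (r r' : labelling) : (forall d, label r d = label r' d) -> r = r'.
Proof. by move=> rr'; apply/matrixP=> x k; apply: (rr' (x, k)). Qed.

Lemma labelB r r' d : label (r - r') d = label r d - label r' d.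
Proof. by rewrite /label !mxE. Qed.

Lemma label0 d : label 0 d = 0.
Proof. by rewrite /label mxE. Qed.

Lemma labelZ a r d : label (a *: r) d = a * label r d.
Proof. by rewrite /label mxE. Qed.

(** 1 at shaded corners, -1 at unshaded ones: these signs alternate around
    each crossing and are opposite at the two darts of an edge. *)
Definition sgn d : K := (-1) ^+ ~~ shaded d.

Lemma sgn_prev d : sgn (prev_dart d) = - sgn d.
Proof. by rewrite /sgn shaded_prev; case: shaded; rewrite ?expr0 ?expr1 ?opprK. Qed.

Lemma sgn_glue d : sgn (glue D d) = - sgn d.
Proof. by rewrite /sgn shaded_glue; case: shaded; rewrite ?expr0 ?expr1 ?opprK. Qed.

Lemma sgn_mul d : sgn d * sgn d = 1.
Proof. by rewrite /sgn; case: shaded; rewrite ?expr0 ?expr1 ?mulr1 ?mulrNN ?mulr1. Qed.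

(** Labellings of the darts that are constant on each edge. *)
Definition edge_labellings : {set labelling} :=
  [set v | [forall d, label v (glue D d) == label v d]].

(** Labellings of the corners that are constant on each region. *)
Definition region_labellings : {set labelling} :=
  [set r | [forall d, label r (next_corner (glue D) d) == label r d]].

(** The alternating sum of the labels around each crossing; the sign that
    this leaves open is chosen so that the two ends of an edge contribute
    with opposite signs. *)
Definition crossing_sum (v : labelling) : 'rV[K]_N :=
  \row_x \sum_(k < 4) sgn (x, k) * label v (x, k).

(** The sum of the labels on the two sides of each edge. *)
Definition side_sum (r : labelling) : labelling :=
  labelling_of (fun d => label r d + label r (prev_dart d)).

Lemma edge_labellingP v :
  reflect (forall d, label v (glue D d) = label v d) (v \in edge_labellings).
Proof. by rewrite inE; apply: 'forall_eqP. Qed.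

Lemma region_labellingP r :
  reflect (forall d, label r (next_corner (glue D) d) = label r d)
    (r \in region_labellings).
Proof. by rewrite inE; apply: 'forall_eqP. Qed.

Lemma edge_labellings_closed : zmod_closed edge_labellings.
Proof.
split=> [|u v /edge_labellingP uP /edge_labellingP vP]; apply/edge_labellingP=> d.
  by rewrite !label0.
by rewrite !labelB uP vP.
Qed.

Lemma region_labellings_closed : zmod_closed region_labellings.
Proof.
split=> [|u v /region_labellingP uP /region_labellingP vP];
  apply/region_labellingP=> d; first by rewrite !label0.
by rewrite !labelB uP vP.
Qed.

Lemma crossing_sumB : {morph crossing_sum : u v / u - v}.
Proof.
move=> u v; apply/rowP=> x; rewrite !mxE -sumrB; apply: eq_bigr => k _.
by rewrite labelB mulrBr.
Qed.

Lemma side_sumB : {morph side_sum : r r' / r - r'}.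
Proof. by move=> r r'; apply: labelP => d; rewrite labelB !labelE !labelB; ring. Qed.

Lemma side_sum_glue r d : r \in region_labellings ->
  label (side_sum r) (glue D d) = label (side_sum r) d.
Proof.
move/region_labellingP=> rP; rewrite !labelE -(rP (glue D d)) /next_corner glueK.
by rewrite addrC -/(next_corner (glue D) d) rP.
Qed.

Lemma crossing_sum_side_sum r : crossing_sum (side_sum r) = 0.
Proof.
apply/rowP=> x; rewrite !mxE.
under eq_bigr => k _ do rewrite labelE mulrDr.
rewrite big_split /= (reindex_inj (addIr (-1 : 'I_4))) -big_split big1 //= => k _.
by rewrite -[(x, k - 1)]/(prev_dart (x, k)) sgn_prev mulNr addNr.
Qed.

(** Labelling a single edge by [a] gives the crossing sums [a] and [- a], in
    some order, at the ends of the edge, and the diagram is connected. *)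
Lemma crossing_sum_delta (d0 d : dart N) (a : K) :
  a *: (delta_mx 0 d.1 - delta_mx 0 d0.1) \in crossing_sum @: edge_labellings.
Proof.
have [I0 IB] := zmod_closed_imset edge_labellings_closed crossing_sumB.
have edge e b : b *: (delta_mx 0 e.1 - delta_mx 0 (glue D e).1)
    \in crossing_sum @: edge_labellings.
  pose f d' : K := sgn e * b * ((d' == e)%:R + (d' == glue D e)%:R).
  apply/imsetP; exists (labelling_of f).
    apply/edge_labellingP=> d'; rewrite !labelE /f.
    by rewrite (inv_eq (@glueK _ D)) (inj_eq (inv_inj (@glueK _ D))) [in LHS]addrC.
  have sum1 x e' : \sum_(k < 4) sgn (x, k) * ((x, k) == e')%:R =
      sgn e' * (x == e'.1)%:R.
    case: e' => y l /=; rewrite (bigD1 l) //= big1 => [|k /negbTE nkl].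
      by rewrite xpair_eqE eqxx andbT addr0; case: eqVneq => [->|]; rewrite ?mulr0.
    by rewrite xpair_eqE nkl andbF mulr0.
  apply/rowP=> x; rewrite !mxE eqxx /=.
  under [RHS]eq_bigr => k _ do rewrite labelE /f mulrCA mulrDr.
  rewrite -mulr_sumr big_split /= !sum1 sgn_glue.
  transitivity (sgn e * sgn e * b * ((x == e.1)%:R - (x == (glue D e).1)%:R)).
    by rewrite sgn_mul mul1r.
  by ring.
pattern d; apply: (dart_ind (D := D) (d0 := d0)) => [|{}d IHd|//].
  by rewrite subrr scaler0.
have -> : a *: (delta_mx 0 (glue D d).1 - delta_mx 0 d0.1) =
    a *: (delta_mx 0 d.1 - delta_mx 0 d0.1) -
    a *: (delta_mx 0 d.1 - delta_mx 0 (glue D d).1) :> 'rV[K]_N.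
  by rewrite -scalerBr; congr (_ *: _); rewrite opprB [RHS]addrC addrA subrK.
exact: IB.
Qed.

(** The vectors of crossing sums and one basis vector generate everything. *)
Lemma card_crossing_sums (x0 : 'I_N) :
  (#|K| ^ N <= #|K| * #|crossing_sum @: edge_labellings|)%N.
Proof.
set I := _ @: _; have [I0 IB] : zmod_closed I.
  exact: zmod_closed_imset edge_labellings_closed crossing_sumB.
have ID u v : u \in I -> v \in I -> u + v \in I.
  by move=> Iu Iv; rewrite -[v]opprK; apply: (IB) => //; rewrite -sub0r; apply: (IB).
pose f (p : K * 'rV[K]_N) := p.2 + p.1 *: delta_mx 0 x0.
have -> : (#|K| ^ N = #|[set: 'rV[K]_N]|)%N by rewrite cardsT card_mx mul1n.
apply: (@leq_trans #|f @: setX [set: K] I|); last first.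
  by rewrite (leq_trans (leq_imset_card _ _)) // cardsX cardsT.
apply/subset_leq_card/subsetP=> u _; apply/imsetP.
exists (\sum_x u 0 x, \sum_x u 0 x *: (delta_mx 0 x - delta_mx 0 x0)).
  rewrite inE in_setT /=; elim/big_ind: _ => // x _.
  exact: (crossing_sum_delta (x0, 0) (x, 0)).
rewrite /f /= scaler_suml -big_split /= [LHS]row_sum_delta.
by apply: eq_bigr => x _; rewrite scalerBr subrK.
Qed.

Lemma card_edge_labellings : (#|edge_labellings| <= #|K| ^ (2 * N))%N.
Proof.
pose f (v : labelling) := [ffun d : {d | shaded d} => label v (val d)].
have -> : (#|K| ^ (2 * N) = #|{ffun {d | shaded d} -> K}|)%N.
  by rewrite card_ffun card_sig -card_shaded cardsE.
rewrite -(card_in_imset (f := f)) ?max_card // => u v /edge_labellingP uP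
  /edge_labellingP vP /ffunP uv.
have uv_sh d : shaded d -> label u d = label v d.
  by move=> sd; have := uv (Sub d sd); rewrite !ffunE.
apply: labelP => d; case: (boolP (shaded d)) => [/uv_sh // | nsd].
by rewrite -uP -vP uv_sh // shaded_glue.
Qed.

(** The count of the regions is where planarity enters. *)
Lemma card_region_labellings : (#|K| ^ (N + 2) <= #|region_labellings|)%N.
Proof.
pose f (rho : {ffun {X | X \in regions D} -> K}) :=
  labelling_of (fun d => rho (Sub (region D d) (mem_regions D d))).
have -> : (#|K| ^ (N + 2) = #|{ffun {X | X \in regions D} -> K}|)%N.
  by rewrite card_ffun card_sig -(planar D).
rewrite -(card_imset _ (f := f)).
  apply/subset_leq_card/subsetP=> _ /imsetP[rho _ ->].
  apply/region_labellingP=> d; rewrite !labelE; congr (rho _).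
  by apply: val_inj; rewrite /= region_next.
move=> rho rho' eq_f; apply/ffunP=> -[X RX]; have /imsetP[d _ dX] := RX.
have := congr1 (label^~ d) eq_f; rewrite !labelE.
by have -> : Sub (region D d) (mem_regions D d) =
    exist (fun X => X \in regions D) X RX by apply: val_inj; rewrite /= dX.
Qed.

(** If all side sums vanish, then [sgn d * label r d] is constant. *)
Lemma side_sum0 r d0 : r \in region_labellings ->
  side_sum r = 0 -> label r d0 = 0 -> r = 0.
Proof.
move=> /region_labellingP rP r0 rd0; apply: labelP => d; rewrite label0.
have rp e : label r (prev_dart e) = - label r e.
  apply/eqP; rewrite -addr_eq0 addrC; apply/eqP.
  by have := congr1 (label^~ e) r0; rewrite labelE label0.
have /(_ d d0) : forall e e', sgn e * label r e = sgn e' * label r e'.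
  apply: (dart_const (D := D)) => e; last by rewrite sgn_prev rp mulrNN.
  by rewrite sgn_glue -[in RHS]rP /next_corner rp mulNr mulrN.
rewrite rd0 mulr0 => /(congr1 ( *%R (sgn d))).
by rewrite mulr0 mulrA sgn_mul mul1r.
Qed.

(** A labelling of the edges with vanishing alternating sum at every crossing
    comes from a labelling of the regions: the former form a group of order at
    most [#|K| ^ (N + 1)], and the image of the latter has at least that
    order, by Euler's formula. *)
Lemma side_sum_onto v : v \in edge_labellings -> crossing_sum v = 0 ->
  exists2 r, r \in region_labellings & v = side_sum r.
Proof.
move=> Ev v0.
have [x0 | noN] := pickP 'I_N; last first.
  exists 0; first by case: region_labellings_closed.
  by apply: labelP => -[x k]; have := noN x.
set Z := [set u in edge_labellings | crossing_sum u == 0].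
have sBZ : side_sum @: region_labellings \subset Z.
  apply/subsetP=> _ /imsetP[r Rr ->]; rewrite inE crossing_sum_side_sum eqxx andbT.
  by apply/edge_labellingP=> d; apply: side_sum_glue.
have kerB : (#|[set r in region_labellings | side_sum r == 0%R]| <= #|K|)%N.
  rewrite -(card_in_imset (f := label^~ (x0, 0))) ?max_card // => r r'.
  rewrite !in_set => /andP[Rr /eqP r0] /andP[Rr' /eqP r'0] eq_rr'.
  apply/subr0_eq/(side_sum0 (d0 := (x0, 0))).
  - by case: region_labellings_closed => _; apply; rewrite in_set.
  - by rewrite side_sumB r0 r'0 subrr.
  - by rewrite labelB eq_rr' subrr.
have leZB : (#|Z| <= #|side_sum @: region_labellings|)%N.
  have q0 : (0 < #|K|)%N by apply/card_gt0P; exists 0.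
  apply: (card_estimate (Q := #|K| ^ N) q0) kerB; first by rewrite expn_gt0 q0.
  - exact: card_additive_image edge_labellings_closed crossing_sumB.
  - by rewrite mulnn -expnM mulnC card_edge_labellings.
  - exact: card_crossing_sums x0.
  - rewrite mulnn -expnD -(card_additive_image region_labellings_closed side_sumB).
    exact: card_region_labellings.
have /eqP eqBZ : side_sum @: region_labellings == Z by rewrite eqEcard sBZ.
have : v \in Z by rewrite inE Ev v0 eqxx.
by rewrite -eqBZ => /imsetP[r]; exists r.
Qed.

Lemma crossing_sum_eq0 v :
    (forall d, label v d + label v (opposite d) =
               label v (prev_dart d) + label v (prev_dart (opposite d))) ->
  crossing_sum v = 0.
Proof.
move=> vP; apply/rowP=> x; rewrite !mxE.
pose d : dart N := (x, 0).
rewrite (sum_crossing (fun e => sgn e * label v e) d) opposite_prev !sgn_prev.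
rewrite -opposite_prev -[RHS](mulr0 (sgn d)) -(subrr (label v d + label v (opposite d))).
by rewrite [in X in _ - X]vP; ring.
Qed.

End Potential.
End Coloured.

(** * Colorings and Dehn labellings *)

Section Kernels.
Variable K : finComPzRingType.

(** The solutions of [A v = 0] over [K]; over [Zmod n] this is [nul n A]. *)
Definition kernel k (A : 'M[int]_k) : {set 'cV[K]_k} :=
  [set v | map_mx intr A *m v == 0].

(** The solutions with first entry 0. *)
Definition kernel0 k (A : 'M[int]_k.+1) : {set 'cV[K]_k.+1} :=
  [set v in kernel A | v ord0 ord0 == 0].

Lemma kernelP k (A : 'M[int]_k) (v : 'cV[K]_k) :
  reflect (forall i, \sum_j (A i j)%:~R * v j 0 = 0) (v \in kernel A).
Proof.
rewrite inE; apply: (iffP eqP) => [/colP Av i | Av].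
  by have := Av i; rewrite !mxE => Avi; rewrite -[RHS]Avi; apply: eq_bigr => j _; rewrite mxE.
by apply/colP=> i; rewrite !mxE -[RHS](Av i); apply: eq_bigr => j _; rewrite mxE.
Qed.

End Kernels.

Section Colorings.
Variables (c : nat) (D : knot_diagram c.+1) (S : {set {set dart c.+1}}).
Hypothesis chk : checkerboard D S.
Variable K : finComPzRingType.
Local Notation N := c.+1.
Local Notation labelling := 'M[K]_(N, 4).
Local Notation region_labellings := (region_labellings D K).
Implicit Types (d : dart N) (r : labelling).

(** Dehn labellings vanishing on both sides of the edge of [d1]. *)
Definition dehn_labellings (d1 : dart N) : {set labelling} :=
  [set r in region_labellings |
    [&& [forall (d | over d), label r d + label r (prev_dart d) ==
           label r (opposite d) + label r (prev_dart (opposite d))],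
        label r d1 == 0 & label r (prev_dart d1) == 0]].

Lemma dehnP d1 r :
  reflect [/\ forall d, label r (next_corner (glue D) d) = label r d,
              forall d, over d -> label r d + label r (prev_dart d) =
                label r (opposite d) + label r (prev_dart (opposite d)),
              label r d1 = 0 & label r (prev_dart d1) = 0]
    (r \in dehn_labellings d1).
Proof.
rewrite in_set; apply: (iffP andP) => [[/region_labellingP rP] | [rP rO r1 r1']].
  by case/and3P=> /forall_inP rO /eqP r1 /eqP r1'; split=> // d /rO /eqP.
split; first exact/region_labellingP.
by rewrite r1 r1' !eqxx !andbT; apply/forall_inP=> d /rO ->.
Qed.

Lemma dehn_labellings_closed d1 : zmod_closed (dehn_labellings d1).
Proof.
split=> [|r r' /dehnP[rP rO r1 r1'] /dehnP[r'P r'O r'1 r'1']]; apply/dehnP.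
  by split=> [d|d _||]; rewrite !label0.
split=> [d|d od||]; rewrite !labelB ?rP ?r'P //.
- rewrite addrACA -opprD rO // r'O //; ring.
- by rewrite r1 r'1 subrr.
- by rewrite r1' r'1' subrr.
Qed.

Section Strands.
Variable alpha : 'I_N -> {set dart N}.
Hypothesis alpha_strands : numbering alpha (strands D).

(** The number of the strand containing [d], and a dart of the strand
    number [j]; the default values are never taken. *)
Definition strand_index d : 'I_N := odflt ord0 [pick j | d \in alpha j].

Definition strand_dart (j : 'I_N) : dart N :=
  odflt (ord0, 0) [pick d | d \in alpha j].

(** Two darts related this way belong to the same strand. *)
Definition strand_rel : rel (dart N) :=
  [rel x y | (y == glue D x) || (over x && (y == opposite x))].

Lemma mem_strand d d' : (d' \in strand D d) = (strand D d == strand D d').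
Proof.
have sym : connect_sym strand_rel.
  apply: (@sym_connect_sym _ strand_rel) => x y.
  rewrite /strand_rel /= [y == glue D x]eq_sym (inv_eq (@glueK _ D)); congr (_ || _).
  by apply/andP/andP => -[ox /eqP ->]; rewrite ?over_opposite ?oppositeK ?eqxx.
apply/idP/eqP => [dd' | ->]; last by rewrite inE.
by apply/setP=> e; rewrite !inE; rewrite inE in dd'; apply: same_connect.
Qed.

Lemma mem_alpha d j : (d \in alpha j) = (strand_index d == j).
Proof.
have [inj im] := alpha_strands.
have aj i : exists d', alpha i = strand D d'.
  have : alpha i \in strands D by rewrite -im imset_f.
  by case/imsetP=> d' _; exists d'.
have dE i : (d \in alpha i) = (alpha i == strand D d).
  by have [d' ->] := aj i; rewrite mem_strand.
have /imsetP[i _ di] : strand D d \in [set alpha i | i : 'I_N].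
  by rewrite im imset_f.
rewrite /strand_index; case: pickP => [i' /= | /(_ i)]; last first.
  by rewrite dE di eqxx.
by rewrite !dE di !(inj_eq inj) => /eqP ->; rewrite eq_sym.
Qed.

Lemma strand_dartK : cancel strand_dart strand_index.
Proof.
move=> j; have [inj im] := alpha_strands; apply/eqP; rewrite -mem_alpha.
rewrite /strand_dart; case: pickP => //= no.
have : alpha j \in strands D by rewrite -im imset_f.
by case/imsetP=> d _ jd; have := no d; rewrite jd inE connect0.
Qed.

Lemma strand_index_glue d : strand_index (glue D d) = strand_index d.
Proof.
apply/eqP; rewrite -mem_alpha; have : d \in alpha (strand_index d).
  by rewrite mem_alpha.
have [inj im] := alpha_strands.
have : alpha (strand_index d) \in strands D by rewrite -im imset_f.
case/imsetP=> e _ ->; rewrite !inE => ed; apply: connect_trans ed _.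
by rewrite connect1 //= eqxx.
Qed.

Lemma strand_index_opposite d :
  over d -> strand_index (opposite d) = strand_index d.
Proof.
move=> od; apply/eqP; rewrite -mem_alpha; have : d \in alpha (strand_index d).
  by rewrite mem_alpha.
have [inj im] := alpha_strands.
have : alpha (strand_index d) \in strands D by rewrite -im imset_f.
case/imsetP=> e _ ->; rewrite !inE => ed; apply: connect_trans ed _.
by rewrite connect1 //= od eqxx orbT.
Qed.

Lemma strand_const (T : Type) (m : dart N -> T) :
    (forall d, m (glue D d) = m d) ->
    (forall d, over d -> m (opposite d) = m d) ->
  forall d d', strand_index d = strand_index d' -> m d = m d'.
Proof.
move=> mg mo d d' /eqP; rewrite eq_sym -mem_alpha.
have [inj im] := alpha_strands.
have : alpha (strand_index d) \in strands D by rewrite -im imset_f.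
case/imsetP=> e _ ae; rewrite ae mem_strand => /eqP ed'.
have : d \in alpha (strand_index d) by rewrite mem_alpha.
rewrite ae mem_strand ed' -mem_strand inE => /connectP[p pth ->] {d ed' ae}.
elim: p d' pth => //= x p IHp d' /andP[dx /IHp ->].
by case/orP: dx => [/eqP-> | /andP[od /eqP->]]; rewrite ?mg ?mo.
Qed.

Variables (chi : 'S_N) (neg : 'I_N -> bool).

Local Notation Ct := (precoloring_mx alpha chi neg).

Lemma sum_mem_alpha d (v : 'cV[K]_N) :
  \sum_j ((d \in alpha j)%:R : int)%:~R * v j 0 = v (strand_index d) 0.
Proof.
rewrite (bigD1 (strand_index d)) //= mem_alpha eqxx mul1r big1 ?addr0 // => j.
by rewrite mem_alpha eq_sym => /negbTE ->; rewrite mul0r.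
Qed.

Lemma kernel_precoloringP (v : 'cV[K]_N) :
  reflect (forall x, v (strand_index (x, 0)) 0 + v (strand_index (x, 2%:R)) 0 =
                     2%:R * v (strand_index (x, 1)) 0)
    (v \in kernel K Ct).
Proof.
have rowE i : \sum_j (Ct i j)%:~R * v j 0 = (-1) ^+ neg i *
    (v (strand_index (chi i, 0)) 0 + v (strand_index (chi i, 2%:R)) 0 -
     2%:R * v (strand_index (chi i, 1)) 0).
  rewrite -!sum_mem_alpha [2%:R * _]mulr_sumr -big_split -sumrB mulr_sumr.
  apply: eq_bigr => j _ /=; rewrite mxE.
  by rewrite rmorphM rmorphXn rmorphN1 rmorphB rmorphD rmorphM /= rmorph_nat; ring.
apply: (iffP (kernelP _ _)) => [vP x | vP i]; last first.
  by rewrite rowE vP subrr mulr0.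
have := vP (chi^-1%g x); rewrite rowE permKV => /(congr1 ( *%R ((-1) ^+ neg (chi^-1%g x)))).
by rewrite mulr0 mulrA -signr_addb addbb mul1r => /subr0_eq.
Qed.

(** The coloring defined by a Dehn labelling. *)
Definition strand_values r : 'cV[K]_N :=
  \col_j label (side_sum r) (strand_dart j).

Lemma strand_valuesE d1 r d : r \in dehn_labellings d1 ->
  strand_values r (strand_index d) 0 = label (side_sum r) d.
Proof.
case/dehnP=> rP rO _ _; rewrite mxE; apply: strand_const (strand_dartK _).
  by move=> e; apply: side_sum_glue; apply/region_labellingP.
by move=> e /rO; rewrite !labelE.
Qed.

Lemma strand_values_bij d1 : d1 \in alpha ord0 ->
  bijects strand_values (dehn_labellings d1) (kernel0 K Ct).
Proof.
rewrite mem_alpha => /eqP s1; split.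
  move=> r r' Ar Ar' eq_rr'; have [rP rO r1 r1'] := dehnP _ _ Ar.
  have [r'P r'O r'1 r'1'] := dehnP _ _ Ar'.
  apply/subr0_eq/(side_sum0 chk (d0 := d1)).
  - have [_] := region_labellings_closed D K; apply; exact/region_labellingP.
  - apply: labelP => d; rewrite side_sumB labelB label0.
    by rewrite -!(strand_valuesE _ Ar) -!(strand_valuesE _ Ar') eq_rr' subrr.
  - by rewrite labelB r1 r'1 subrr.
apply/setP=> v; apply/imsetP/idP => [[r Ar ->] | ].
  have [rP rO r1 r1'] := dehnP _ _ Ar; rewrite in_set; apply/andP; split.
    apply/kernel_precoloringP=> x; rewrite !(strand_valuesE _ Ar) !labelE.
    have := rO (x, 1) isT; rewrite under_prev under_prev_opposite opposite_prev prev4.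
    set a := label r _; set b := label r _; set e := label r _ => eq1.
    set e' := label r _ in eq1 *.
    transitivity ((a + b) + (e + e')); first by ring.
    by rewrite -eq1; ring.
  by rewrite -s1 (strand_valuesE _ Ar) labelE r1 r1' addr0.
rewrite in_set => /andP[/kernel_precoloringP vP /eqP v0].
pose V : labelling := labelling_of (fun d => v (strand_index d) 0).
have EV : V \in edge_labellings D K.
  by apply/edge_labellingP=> d; rewrite !labelE strand_index_glue.
have VO d : over d -> label V (prev_dart d) + label V (prev_dart (opposite d)) =
    label V d + label V (opposite d).
  move=> od; rewrite !labelE strand_index_opposite //.
  have := vP d.1; rewrite under_prev under_prev_opposite mulr_natl mulr2n.
  case: (over_eq od) => -> //=; rewrite strand_index_opposite // oppositeK => <-.
  exact: addrC.
have V0 : crossing_sum D S V = 0.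
  apply: crossing_sum_eq0 => // d; case: (boolP (over d)) => [/VO -> // | od].
  have := VO (prev_dart d); rewrite over_prev od => /(_ isT).
  by rewrite !opposite_prev prev4 addrC => ->.
have [r Rr Vr] := side_sum_onto chk EV V0.
have /region_labellingP rP := Rr.
(* A multiple of the labelling [sgn], whose side sums vanish, is subtracted to
   make the label of [d1] zero; that of [prev_dart d1] is then the value of the
   coloring at the first strand, which is zero. *)
pose r0 : labelling := r - (sgn D S K d1 * label r d1) *: labelling_of (sgn D S K).
have side0 : side_sum r0 = side_sum r.
  apply: labelP => d; rewrite !labelE !labelB !labelZ !labelE sgn_prev //; ring.
have r0P : r0 \in region_labellings.
  apply/region_labellingP=> d; rewrite !labelB !labelZ !labelE rP; congr (_ - _ * _).
  by rewrite /sgn shaded_next.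
have r01 : label r0 d1 = 0.
  by rewrite labelB labelZ labelE mulrAC sgn_mul mul1r subrr.
have sE d : label (side_sum r0) d = v (strand_index d) 0.
  by rewrite side0 -Vr labelE.
have Ar0 : r0 \in dehn_labellings d1.
  apply/dehnP; split=> //; first exact/region_labellingP.
    by move=> d od; have := sE (opposite d); rewrite strand_index_opposite // -sE !labelE => ->.
  by have := sE d1; rewrite labelE r01 add0r s1 => ->.
exists r0 => //; apply/colP=> j; rewrite -[in RHS](strand_dartK j).
by rewrite (strand_valuesE _ Ar0) sE strand_dartK.
Qed.

End Strands.
End Colorings.

(** * Goeritz equations and Dehn labellings *)

(** A function whose sum over each orbit of a permutation [f] vanishes is a
    difference [t (f x) - t x]. *)
Lemma orbit_primitive (T : finType) (V : zmodType) (f : T -> T) (k : T -> V) :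
    injective f -> (forall x, \sum_(y | fconnect f x y) k y = 0) ->
  exists t : T -> V, forall x, t (f x) = t x + k x.
Proof.
move=> inj k0.
(* The partial sums along each orbit, from its canonical element [froot f x]. *)
pose t x := \sum_(i < findex f (froot f x) x) k (iter i f (froot f x)).
exists t => x; rewrite /t; have symf := fconnect_sym inj.
have -> : froot f (f x) = froot f x.
  by apply/eqP; rewrite (root_connect symf) symf fconnect1.
set z := froot f x; have zx : fconnect f z x by rewrite symf connect_root.
set n := findex f z x; have ltn : (n < fingraph.order f z)%N by apply: findex_max.
have [lt | ge] := ltnP n.+1 (fingraph.order f z).
  have -> : findex f z (f x) = n.+1.
    by rewrite -[x in f x](iter_findex zx) -iterS findex_iter.
  by rewrite big_ord_recr /= iter_findex.
have ordz : fingraph.order f z = n.+1 by apply/eqP; rewrite eqn_leq ge ltn.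
have -> : f x = z by rewrite -(iter_findex zx) -iterS -/n -ordz iter_order.
rewrite findex0 big_ord0 -[LHS](k0 z).
have sum_traject m : \sum_(y <- traject f z m) k y = \sum_(i < m) k (iter i f z).
  by elim: m => [|m IHm]; rewrite ?big_nil ?big_ord0 // trajectSr big_rcons big_ord_recr IHm.
transitivity (\sum_(y <- fingraph.orbit f z) k y).
  by rewrite (eq_bigl _ _ (fconnect_orbit f z)) -big_uniq ?fingraph.orbit_uniq.
by rewrite sum_traject ordz big_ord_recr /= iter_findex.
Qed.

Section Goeritz.
Variables (c : nat) (D : knot_diagram c.+1) (S : {set {set dart c.+1}}).
Hypothesis chk : checkerboard D S.
Variable K : finComPzRingType.
Local Notation N := c.+1.
Local Notation labelling := 'M[K]_(N, 4).
Local Notation region_labellings := (region_labellings D K).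
Local Notation shaded := (shaded_corner D S).
Implicit Types (d : dart N) (r : labelling).

Section Regions.
Variables (s : nat) (R : 'I_s.+1 -> {set dart N}).
Hypothesis R_shaded : numbering R S.

(** The number of the shaded region at the corner [d], and a corner of the
    shaded region number [i]; [region_index d] is meaningful only for shaded
    [d]. *)
Definition region_index d : 'I_s.+1 := odflt ord0 [pick i | d \in R i].

Definition region_dart (i : 'I_s.+1) : dart N :=
  odflt (ord0, 0) [pick d | d \in R i].

(** At shaded corners this is the sign [eta] of the crossing. *)
Definition osgn d : K := (-1) ^+ over d.

Lemma osgn_opposite d : osgn (opposite d) = osgn d.
Proof. by rewrite /osgn over_opposite. Qed.

Lemma R_region i : exists d, R i = region D d.
Proof.
have [inj im] := R_shaded; have [/subsetP sub _] := chk.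
have /sub /imsetP[d _ ->] : R i \in S by rewrite -im imset_f.
by exists d.
Qed.

Lemma mem_R_region d i : (d \in R i) = (R i == region D d).
Proof. by have [e ->] := R_region i; rewrite mem_region. Qed.

Lemma mem_R d i : (d \in R i) = shaded d && (region_index d == i).
Proof.
have [inj im] := R_shaded; rewrite /region_index; case: pickP => [j | no] /=.
  rewrite !mem_R_region => /eqP dj; rewrite -dj (inj_eq inj) eq_sym.
  by rewrite /shaded_corner -dj -im imset_f.
rewrite no; apply/esym/negbTE/nandP; left; apply/negP.
rewrite /shaded_corner -im => /imsetP[j _ dj].
by have := no j; rewrite mem_R_region dj eqxx.
Qed.

Lemma region_index_next d :
  shaded d -> region_index (next_corner (glue D) d) = region_index d.
Proof.
move=> sd; have : d \in R (region_index d) by rewrite mem_R sd eqxx.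
by rewrite mem_R_region -region_next -mem_R_region mem_R => /andP[_ /eqP].
Qed.

Lemma region_dartP i : shaded (region_dart i) /\ region_index (region_dart i) = i.
Proof.
suff: region_dart i \in R i by rewrite mem_R => /andP[-> /eqP].
rewrite /region_dart; case: pickP => //= no; have [d Rd] := R_region i.
by have := no d; rewrite Rd mem_region eqxx.
Qed.

(** The term of the Goeritz equations contributed by a shaded corner, for
    the values [w] at the shaded regions. *)
Definition goeritz_term (w : 'cV[K]_s.+1) d : K :=
  osgn d * (w (region_index (opposite d)) 0 - w (region_index d) 0).

Lemma shaded_over d : shaded d = shaded (d.1, 0) (+) over d.
Proof.
case: d => x k /=; have := @crossing_darts _ (x, 0) (x, k) erefl.
by case=> ->; rewrite ?over_prev ?over_opposite ?(shaded_prev chk)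
  ?(shaded_opposite chk) ?addbF ?addbT.
Qed.

Lemma etaE x : eta D S x = (-1) ^+ ~~ shaded (x, 0).
Proof.
rewrite /eta; have -> : (x, 2%:R) = opposite (x, 0) :> dart N.
  by congr (_, _); apply: val_inj.
have := shaded_opposite chk (x, 0); rewrite /shaded_corner /region => ->.
by rewrite andbb; case: ifP.
Qed.

Lemma eta_shaded d : shaded d -> (eta D S d.1)%:~R = osgn d.
Proof.
rewrite etaE shaded_over /osgn; case: (shaded _); case: (over d) => //= _.
Qed.

Lemma shaded_dart x : exists2 p, shaded p & p.1 = x.
Proof.
case: (boolP (shaded (x, 0))) => [|np]; first by exists (x, 0).
by exists (prev_dart (x, 0)); rewrite // (shaded_prev chk).
Qed.

Local Notation Gt := (pregoeritz_mx D S R).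

Lemma incident_R p j : shaded p ->
  incident (R j) p.1 = (region_index p == j) || (region_index (opposite p) == j).
Proof.
move=> sp; apply/existsP/orP => [[k] | [] Ej].
- rewrite mem_R => /andP[sk Ej]; have := @crossing_darts _ p (p.1, k) erefl.
  case=> pk; move: sk Ej; rewrite pk ?(shaded_prev chk) ?(shaded_opposite chk) ?sp //; auto.
- by exists p.2; rewrite -surjective_pairing mem_R sp.
- by exists (opposite p).2; rewrite -[(_, _)]/(opposite p) mem_R (shaded_opposite chk) sp.
Qed.

(** The contribution of one crossing to the Goeritz equation of [R i].  If
    both shaded corners belong to [R i], the left side has no term and the
    two terms of the right side vanish. *)
Lemma goeritz_crossing (w : 'cV[K]_s.+1) i x :
  \sum_(j | j != i) (if incident (R i) x && incident (R j) x
                     then (eta D S x)%:~R * (w j 0 - w i 0) else 0) =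
  \sum_(k < 4) (if (x, k) \in R i then goeritz_term w (x, k) else 0).
Proof.
have [p sp <-] := shaded_dart x.
rewrite (sum_crossing (fun e => if e \in R i then goeritz_term w e else 0)).
rewrite !mem_R !(shaded_prev chk) !(shaded_opposite chk) sp /= !addr0.
under eq_bigr => j _ do rewrite !incident_R // eta_shaded //.
rewrite /goeritz_term osgn_opposite oppositeK.
set a := region_index p; set b := region_index (opposite p).
have [ai | nai] := eqVneq a i; have [bi | nbi] := eqVneq b i => /=.
- rewrite ai bi !subrr !mulr0 addr0 big1 // => j ji.
  by rewrite eq_sym (negbTE ji).
- rewrite addr0 (bigD1 b) // big1 /= => [|j /andP[ji jb]]; last first.
    by rewrite ai eq_sym (negbTE ji) eq_sym (negbTE jb).
  by rewrite eqxx orbT addr0 ai.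
- rewrite add0r (bigD1 a) // big1 /= => [|j /andP[ji ja]]; last first.
    by rewrite bi eq_sym (negbTE ja) eq_sym (negbTE ji).
  by rewrite eqxx addr0 bi.
- by rewrite addr0 big1.
Qed.

Lemma goeritz_rowE (w : 'cV[K]_s.+1) i :
  \sum_j (Gt i j)%:~R * w j 0 = \sum_(d in R i) goeritz_term w d.
Proof.
transitivity (\sum_(j | j != i)
    (pregoeritz_offdiag D S (R i) (R j))%:~R * (w j 0 - w i 0)).
  rewrite (bigD1 i) //= mxE eqxx rmorphN rmorph_sum mulNr mulr_suml -sumrN -big_split.
  apply: eq_bigr => j ji; rewrite mxE eq_sym (negbTE ji) /=; ring.
have -> : \sum_(d in R i) goeritz_term w d =
    \sum_x \sum_k if (x, k) \in R i then goeritz_term w (x, k) else 0.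
  by rewrite big_mkcond pair_bigA; apply: eq_bigr => -[].
under eq_bigr => j _ do rewrite rmorph_sum mulr_suml big_mkcond.
by rewrite exchange_big; apply: eq_bigr => x _; apply: goeritz_crossing.
Qed.

Lemma kernel_pregoeritzP (w : 'cV[K]_s.+1) :
  reflect (forall i, \sum_(d in R i) goeritz_term w d = 0) (w \in kernel K Gt).
Proof. by apply: (iffP (kernelP _ _)) => wP i; have := wP i; rewrite goeritz_rowE. Qed.

(** The labels of the shaded regions. *)
Definition region_values r : 'cV[K]_s.+1 := \col_i label r (region_dart i).

Lemma region_valuesE r d : r \in region_labellings -> shaded d ->
  region_values r (region_index d) 0 = label r d.
Proof.
move=> /region_labellingP rP sd; rewrite mxE; apply: (region_const rP).
have [sd' eq_i] := region_dartP (region_index d).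
have : d \in R (region_index d) by rewrite mem_R sd eqxx.
have : region_dart (region_index d) \in R (region_index d) by rewrite mem_R sd' eq_i eqxx.
by rewrite !mem_R_region => /eqP <- /eqP <-.
Qed.

(** The condition at a crossing, seen from its shaded corners: the difference
    of the shaded labels is, up to sign, that of the unshaded ones. *)
Lemma dehn_shaded r :
  (forall d, over d -> label r d + label r (prev_dart d) =
     label r (opposite d) + label r (prev_dart (opposite d))) <->
  (forall d, shaded d -> osgn d * (label r (opposite d) - label r d) =
     label r (prev_dart (opposite d)) - label r (prev_dart d)).
Proof.
have to0 (a b : K) : a = b -> a - b = 0 by move=> ->; rewrite subrr.
split=> [rO d sd | rS d od].
  rewrite /osgn; case: (boolP (over d)) => [/rO /to0 eq0 | od].
    by apply/subr0_eq; rewrite -[RHS]eq0; ring.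
  have /rO /to0 : over (prev_dart d) by rewrite over_prev.
  by rewrite !opposite_prev prev4 => eq0; apply/subr0_eq; rewrite -[RHS]eq0; ring.
case: (boolP (shaded d)) => [/rS /to0 | nsd].
  by rewrite /osgn od => eq0; apply/subr0_eq; rewrite -[RHS]eq0; ring.
have /rS /to0 : shaded (prev_dart d) by rewrite (shaded_prev chk).
rewrite /osgn over_prev od !opposite_prev prev4 => eq0.
by apply/subr0_eq; rewrite -[RHS]oppr0 -[X in _ = - X]eq0; ring.
Qed.

Local Notation dehn_labellings := (@dehn_labellings c D K).

Lemma region_values_kernel d1 r :
  r \in dehn_labellings d1 -> region_values r \in kernel K Gt.
Proof.
case/dehnP=> rP /dehn_shaded rS _ _; have Rr : r \in region_labellings.
  exact/region_labellingP.
apply/kernel_pregoeritzP=> i.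
have -> : \sum_(d in R i) goeritz_term (region_values r) d =
    \sum_(d in R i) (label r (prev_dart (opposite d)) - label r (prev_dart d)).
  apply: eq_bigr => d; rewrite mem_R => /andP[sd _].
  by rewrite /goeritz_term !region_valuesE ?(shaded_opposite chk) // rS.
rewrite sumrB (reindex_inj (@next_corner_inj _ D)) /=.
apply/eqP; rewrite subr_eq0; apply/eqP; apply: eq_big => [d | d _].
  by rewrite !mem_R_region region_next.
by rewrite /next_corner opposite_prev prev4 -rP /next_corner glueK.
Qed.

(** If the shaded labels vanish, then the unshaded ones are all equal. *)
Lemma dehn_eq0 d1 r : d1 \in R ord0 -> r \in dehn_labellings d1 ->
  region_values r = 0 -> r = 0.
Proof.
rewrite mem_R => /andP[sd1 _] /dehnP[rP /dehn_shaded rS r1 r1'] r0.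
have Rr : r \in region_labellings by apply/region_labellingP.
have rs d : shaded d -> label r d = 0.
  by move=> sd; rewrite -region_valuesE // r0 mxE.
(* [m d] is the label of the unshaded side of the edge of [d]. *)
pose m d := if shaded d then label r (prev_dart d) else label r d.
have mc : forall d d', m d = m d'.
  apply: (dart_const (D := D)) => d; rewrite /m ?(shaded_glue chk) ?(shaded_prev chk).
    case: (shaded d) => /=; first by rewrite -rP /next_corner glueK.
    by rewrite -(rP d).
  case: (boolP (shaded d)) => //= nsd; apply/subr0_eq.
  have sp : shaded (prev_dart d) by rewrite (shaded_prev chk).
  have := rS _ sp; rewrite (rs _ sp) (rs (opposite _)) ?(shaded_opposite chk) //.
  by rewrite subrr mulr0 !opposite_prev prev4 => eq0; rewrite -[RHS]oppr0 eq0 opprB.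
apply: labelP => d; rewrite label0; case: (boolP (shaded d)) => [/rs // | nsd].
by have := mc d d1; rewrite /m sd1 (negbTE nsd) r1'.
Qed.

(** The Goeritz equations allow one to integrate the differences of the labels of
    unshaded regions around every shaded region, into an edge labelling. *)
Lemma dehn_of_goeritz d1 (w : 'cV[K]_s.+1) :
    d1 \in R ord0 -> w \in kernel0 K Gt ->
  exists2 r, r \in dehn_labellings d1 & region_values r = w.
Proof.
rewrite mem_R inE => /andP[sd1 /eqP i1] /andP[/kernel_pregoeritzP wP /eqP w0].
set nc := next_corner (glue D).
have ncs d : shaded (nc d) = shaded d by rewrite shaded_next.
pose k d := if shaded d then - goeritz_term w (nc d) else 0.
have /(orbit_primitive (@next_corner_inj _ D))[t tP] :
    forall d, \sum_(e | fconnect nc d e) k e = 0.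
  move=> d; have reg e : fconnect nc d e = (e \in region D d) by rewrite inE.
  case: (boolP (shaded d)) => [sd | nsd]; last first.
    apply: big1 => e; rewrite reg mem_region /k /shaded_corner => /eqP <-.
    by rewrite -/(shaded d) (negbTE nsd).
  have di : R (region_index d) = region D d.
    by apply/eqP; rewrite -mem_R_region mem_R sd eqxx.
  rewrite -[RHS]oppr0 -[X in _ = - X](wP (region_index d)) -sumrN.
  rewrite [RHS](reindex_inj (@next_corner_inj _ D)) /=; apply: eq_big => e.
    by rewrite reg di !mem_region region_next.
  by rewrite reg mem_region /k /shaded_corner => /eqP <-; rewrite -/(shaded d) sd.
pose v : labelling := labelling_of (fun d => if shaded d then t d else t (glue D d)).
have Ev : v \in edge_labellings D K.
  apply/edge_labellingP=> d; rewrite !labelE (shaded_glue chk) glueK.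
  by case: (shaded d).
(* Here [prev_dart (opposite d)] is the counterclockwise successor of [d]. *)
have vP d : shaded d ->
    label v (prev_dart (opposite d)) = label v d + goeritz_term w d.
  move=> sd; rewrite !labelE (shaded_prev chk) (shaded_opposite chk) sd /=.
  set e := glue D _; have se : shaded e.
    by rewrite (shaded_glue chk) (shaded_prev chk) (shaded_opposite chk) sd.
  have ed : nc e = d by rewrite /nc /next_corner glueK opposite_prev prev4.
  by rewrite -[in t d]ed tP /k se ed addrNK.
have gopp d : goeritz_term w (opposite d) = - goeritz_term w d.
  by rewrite /goeritz_term osgn_opposite oppositeK -mulrN opprB.
have vC d : shaded d -> label v d + label v (opposite d) =
    label v (prev_dart d) + label v (prev_dart (opposite d)).
  move=> sd; have := vP _ (etrans (shaded_opposite chk d) sd).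
  rewrite oppositeK gopp => ->; rewrite vP //; ring.
have v0 : crossing_sum D S v = 0.
  apply: (crossing_sum_eq0 chk) => d; case: (boolP (shaded d)) => [/vC // | nsd].
  have /vC : shaded (prev_dart d) by rewrite (shaded_prev chk).
  by rewrite !opposite_prev prev4 => ->; rewrite addrC.
have [u Ru vu] := side_sum_onto chk Ev v0.
have /region_labellingP uP := Ru.
(* The shaded labels of [u] are unrelated to [w] and are discarded: only the
   differences of the unshaded ones matter. *)
pose r : labelling := labelling_of (fun d =>
  if shaded d then w (region_index d) 0 else label u d - label u (prev_dart d1)).
have Rr d : label r (next_corner (glue D) d) = label r d.
  rewrite !labelE shaded_next; case: (boolP (shaded d)) => sd.
    by rewrite region_index_next.
  by rewrite uP.
exists r; last first.
  apply/colP=> i; have [si ii] := region_dartP i.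
  by rewrite mxE labelE si ii.
apply/dehnP; split=> //.
- apply/dehn_shaded=> d sd; rewrite !labelE !(shaded_prev chk) !(shaded_opposite chk) sd /=.
  rewrite -/(goeritz_term w d).
  have := vP _ sd; rewrite vu !labelE -opposite_prev oppositeK => eq_u.
  have -> : goeritz_term w d =
    label u (prev_dart (opposite d)) + label u d - (label u d + label u (prev_dart d)).
    by rewrite eq_u addrC addKr.
  ring.
- by rewrite labelE sd1 i1.
- by rewrite labelE (shaded_prev chk) sd1 subrr.
Qed.

Lemma region_values_bij d1 : d1 \in R ord0 ->
  bijects region_values (dehn_labellings d1) (kernel0 K Gt).
Proof.
move=> R1; have := R1; rewrite mem_R => /andP[sd1 /eqP i1]; split.
  move=> r r' Ar Ar' eq_rr'; apply/subr0_eq/(dehn_eq0 R1).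
    by have [_] := dehn_labellings_closed D K d1; apply.
  apply/colP=> i; have /colP/(_ i) := eq_rr'; rewrite !mxE labelB => ->.
  by rewrite subrr.
apply/setP=> w; apply/imsetP/idP => [[r Ar ->] | /(dehn_of_goeritz R1)[r Ar <-]].
  rewrite in_set (region_values_kernel Ar) -i1 region_valuesE //.
    by case/dehnP: Ar => _ _ -> _; rewrite eqxx.
  by case/dehnP: Ar => rP _ _ _; apply/region_labellingP.
by exists r.
Qed.

Lemma pregoeritz_col_sum j : \sum_i Gt i j = 0.
Proof.
rewrite (bigD1 j) //= mxE eqxx -sumrN -big_split big1 //= => i ij.
rewrite mxE (negbTE ij) -[X in - X](_ : pregoeritz_offdiag D S (R i) (R j) = _).
  by rewrite addNr.
by apply: eq_bigl => x; rewrite andbC.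
Qed.

End Regions.

(** With the signs [eta] the coloring equations add up to zero: every edge has
    a shaded and an unshaded dart, whose contributions are opposite. *)
Lemma precoloring_col_sum (alpha : 'I_N -> {set dart N}) (chi : 'S_N)
    (neg : 'I_N -> bool) j :
    numbering alpha (strands D) ->
  \sum_i (-1) ^+ neg i * eta D S (chi i) * precoloring_mx alpha chi neg i j = 0.
Proof.
move=> alphaP; pose F d : int := (-1) ^+ (~~ shaded d) * (d \in alpha j)%:R.
have F_glue d : F (glue D d) = - F d.
  rewrite /F !(mem_alpha alphaP) (strand_index_glue alphaP) (shaded_glue chk).
  by rewrite signrN mulNr.
have F0 : \sum_d F d = 0.
  have : \sum_d F d = - \sum_d F d; last by lia.
  rewrite -sumrN {1}(reindex_inj (inv_inj (@glueK _ D))).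
  by apply: eq_bigr => d _; rewrite F_glue.
transitivity (\sum_x \sum_k F (x, k)); last first.
  by rewrite pair_bigA -[RHS]F0; apply: eq_bigr => -[].
rewrite [RHS](reindex_inj (@perm_inj _ chi)) /=; apply: eq_bigr => i _.
rewrite (sum_crossing F (chi i, 1)) mxE etaE under_prev under_prev_opposite /F.
rewrite !(shaded_prev chk) !(shaded_opposite chk) !(mem_alpha alphaP).
rewrite (strand_index_opposite alphaP (d := (chi i, 1))) //.
rewrite !signrN !opprK; have := sqrr_sign int (neg i).
move: ((-1) ^+ neg i) ((-1) ^+ shaded _) => y z y2.
move: (_ == j)%:R (_ == j)%:R (_ == j)%:R => a b e.
transitivity (y ^+ 2 * z * (e + b - 2%:R * a)); first by ring.
by rewrite y2; ring.
Qed.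

End Goeritz.

(** * Bijections between null spaces *)

Section Bijections.

Lemma bijects_can (T U : finType) (f : T -> U) (g : U -> T)
    (A : {set T}) (B : {set U}) :
    {in A, forall x, f x \in B} -> {in B, forall y, g y \in A} ->
    {in A, cancel f g} -> {in B, cancel g f} ->
  bijects f A B.
Proof.
move=> fP gP fK gK; split; first exact: can_in_inj fK.
apply/setP=> y; apply/imsetP/idP => [[x Ax ->] | By]; first exact: fP.
by exists (g y); rewrite ?gP ?gK.
Qed.

Lemma bijects_comp (T U V : finType) (f : T -> U) (g : U -> V)
    (A : {set T}) (B : {set U}) (C : {set V}) :
  bijects f A B -> bijects g B C -> bijects (g \o f) A C.
Proof.
move=> [fI fA] [gI gB]; split; last by rewrite imset_comp fA.
by move=> x y Ax Ay /= /gI/fI; apply=> //; rewrite -fA imset_f.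
Qed.

Lemma bijects_card (T U : finType) (f : T -> U) (A : {set T}) (B : {set U}) :
  bijects f A B -> #|A| = #|B|.
Proof. by case=> fI <-; rewrite card_in_imset. Qed.

Lemma bijects_neq (T U : finType) (f : T -> U) (A : {set T}) (B : {set U}) x0 y0 :
    f x0 = y0 -> x0 \in A -> bijects f A B ->
  bijects f [set x in A | x != x0] [set y in B | y != y0].
Proof.
move=> fx0 A0 [fI fA]; split.
  by move=> x y; rewrite !inE => /andP[Ax _] /andP[Ay _]; apply: fI.
apply/setP=> y; rewrite inE -fA; apply/imsetP/andP => [[x] | []].
  rewrite inE => /andP[Ax nx] ->; split; first exact: imset_f.
  by apply: contra nx => /eqP; rewrite -fx0 => /fI ->.
case/imsetP=> x Ax -> ny; exists x => //; rewrite inE Ax.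
by apply: contra ny => /eqP ->; rewrite fx0.
Qed.

Variable K : finComPzRingType.

(** Two injective linear maps [f] and [h] on a submodule [A] give a linear
    bijection between their images, sending [f r] to [h r]. *)
Lemma linear_bijection m n a b (A : {set 'M[K]_(m, n)})
    (f : 'M[K]_(m, n) -> 'cV[K]_a) (h : 'M[K]_(m, n) -> 'cV[K]_b)
    (B : {set 'cV[K]_a}) (C : {set 'cV[K]_b}) :
    submod_closed A -> linear f -> linear h -> bijects f A B -> bijects h A C ->
  exists g : 'cV[K]_a -> 'cV[K]_b, [/\ g 0 = 0, linear_on (mem B) g & bijects g B C].
Proof.
move=> [A0 Alin] flin hlin [fI fA] [hI hA].
pose inv v := odflt 0 [pick r in A | f r == v].
have invP v : v \in B -> inv v \in A /\ f (inv v) = v.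
  rewrite -fA => /imsetP[r Ar ->]; rewrite /inv; case: pickP => /= [r' | /(_ r)].
    by case/andP=> Ar' /eqP.
  by rewrite Ar eqxx.
have f0 : f 0 = 0 by have := flin (-1) 0 0; rewrite scaler0 addr0 scaleN1r addNr.
have h0 : h 0 = 0 by have := hlin (-1) 0 0; rewrite scaler0 addr0 scaleN1r addNr.
have hD r r' : h (r + r') = h r + h r' by rewrite -[r in LHS]scale1r hlin scale1r.
have hZ x r : h (x *: r) = x *: h r by rewrite -[x *: r]addr0 hlin h0 addr0.
have invE r : r \in A -> inv (f r) = r.
  move=> Ar; have [|Ar' e] := invP (f r); first by rewrite -fA imset_f.
  exact: fI.
have invlin x r r' : r \in A -> r' \in A -> inv (x *: f r + f r') = x *: r + r'.
  by move=> Ar Ar'; rewrite -flin invE // Alin.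
exists (fun v => h (inv v)); split.
- by rewrite -[X in inv X]f0 invE.
- split=> [u v /invP[Au uE] /invP[Av vE] | x u /invP[Au uE]].
    by have := invlin 1 _ _ Au Av; rewrite uE vE !scale1r => ->; rewrite hD.
  by have := invlin x _ _ Au A0; rewrite uE f0 !addr0 => ->; rewrite hZ.
- split=> [u v /invP[Au <-] /invP[Av <-] | ].
    by rewrite !invE // => /hI ->.
  by rewrite -fA -imset_comp -hA; apply: eq_in_imset => r Ar /=; rewrite invE.
Qed.

End Bijections.

Section DeleteFirst.
Variable K : finComPzRingType.

(** The vector [v] preceded by a zero entry. *)
Definition cons0 k (v : 'cV[K]_k) : 'cV[K]_k.+1 :=
  \col_i if unlift ord0 i is Some j then v j 0 else 0.

Section Redundant.
(* The first equation is a consequence of the other ones. *)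
Variables (k : nat) (A : 'M[int]_k.+1) (y : 'I_k.+1 -> int).
Hypothesis y0 : y ord0 * y ord0 = 1.
Hypothesis yA : forall j, \sum_i y i * A i j = 0.

Let rowsP (v : 'cV[K]_k.+1) i : v ord0 0 = 0 ->
  \sum_j (A (lift ord0 i) j)%:~R * v j 0 =
  \sum_j (delete_first A i j)%:~R * (row' ord0 v) j 0.
Proof.
move=> v0; rewrite big_ord_recl v0 mulr0 add0r; apply: eq_bigr => j _.
by rewrite !mxE.
Qed.

Let drop_kernel :
  {in kernel0 K A, forall v, (row' ord0 v : 'cV[K]_k) \in kernel K (delete_first A)}.
Proof.
move=> v; rewrite inE => /andP[/kernelP vP /eqP v0]; apply/kernelP=> i.
by rewrite -rowsP.
Qed.

Let cons0K : cancel (@cons0 k) (row' ord0).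
Proof. by move=> v; apply/colP=> i; rewrite !mxE liftK. Qed.

Let cons0_kernel :
  {in kernel K (delete_first A), forall v, cons0 v \in kernel0 K A}.
Proof.
move=> v /kernelP vP; rewrite in_set.
have v0 : cons0 v ord0 0 = 0 by rewrite mxE unlift_none.
rewrite v0 eqxx andbT; apply/kernelP.
have rows i : \sum_j (A (lift ord0 i) j)%:~R * cons0 v j 0 = 0.
  by rewrite rowsP // cons0K.
move=> i; case: (unliftP ord0 i) => [j -> // | ->].
pose row_sum i : K := \sum_j (A i j)%:~R * cons0 v j 0.
have : \sum_i (y i)%:~R * row_sum i = 0.
  under eq_bigr => l _ do rewrite mulr_sumr.
  rewrite exchange_big big1 //= => j _.
  under eq_bigr => l _ do rewrite mulrA -rmorphM.
  by rewrite -mulr_suml -rmorph_sum yA mul0r.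
rewrite big_ord_recl big1 ?addr0 => [|j _]; last first.
  by rewrite /row_sum rows mulr0.
move/(congr1 ( *%R (y ord0)%:~R)).
by rewrite mulr0 mulrA -rmorphM y0 mul1r.
Qed.

Let dropK : {in kernel0 K A, cancel (row' ord0 : 'cV_k.+1 -> 'cV_k) (@cons0 k)}.
Proof.
move=> v; rewrite inE => /andP[_ /eqP v0]; apply/colP=> i; rewrite mxE.
by case: (unliftP ord0 i) => [j -> | ->]; rewrite ?mxE.
Qed.

Lemma delete_first_bij :
  bijects (row' ord0 : 'cV_k.+1 -> 'cV_k) (kernel0 K A) (kernel K (delete_first A)).
Proof. exact: bijects_can drop_kernel cons0_kernel dropK (in1W cons0K). Qed.

Lemma cons0_bij : bijects (@cons0 k) (kernel K (delete_first A)) (kernel0 K A).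
Proof. exact: bijects_can cons0_kernel drop_kernel (in1W cons0K) dropK. Qed.

End Redundant.
End DeleteFirst.

Lemma card_kernel (p k : nat) (A : 'M[int]_k) :
  #|kernel 'F_p A| = (#|'F_p| ^ nullity 'F_p A)%N.
Proof.
rewrite /nullity -(@card_vspace _ 'cV['F_p]_k); apply: eq_card => v.
by rewrite inE memv_ker lfunE.
Qed.

(** * The isomorphism *)

Section Isomorphism.
Variables (c s : nat) (D : knot_diagram c.+1) (S : {set {set dart c.+1}}).
Hypothesis S_checkerboard : checkerboard D S.
Variables (alpha : 'I_c.+1 -> {set dart c.+1}) (R : 'I_s.+1 -> {set dart c.+1}).
Hypotheses (alpha_strands : numbering alpha (strands D))
  (R_shaded : numbering R S) (alpha1_R1 : bounds (alpha ord0) (R ord0)).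
Variables (chi : {perm 'I_c.+1}) (neg : 'I_c.+1 -> bool).
Variable K : finComPzRingType.

Local Notation Ct := (precoloring_mx alpha chi neg).
Local Notation Gt := (pregoeritz_mx D S R).

Lemma coloring_drop_bij :
  bijects (row' ord0 : 'cV_c.+1 -> 'cV_c) (kernel0 K Ct) (kernel K (delete_first Ct)).
Proof.
apply: (@delete_first_bij _ _ _ (fun i => (-1) ^+ neg i * eta D S (chi i))) => [|j].
  by rewrite etaE // mulrACA -!expr2 !sqrr_sign mulr1.
exact: precoloring_col_sum.
Qed.

Lemma goeritz_drop_bij :
  bijects (row' ord0 : 'cV_s.+1 -> 'cV_s) (kernel0 K Gt) (kernel K (delete_first Gt)).
Proof.
apply: (@delete_first_bij _ _ _ (fun=> 1)) => [|j]; first exact: mulr1.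
by under eq_bigr do rewrite mul1r; apply: pregoeritz_col_sum.
Qed.

Lemma goeritz_cons0_bij :
  bijects (@cons0 K s) (kernel K (delete_first Gt)) (kernel0 K Gt).
Proof.
apply: (@cons0_bij _ _ _ (fun=> 1)) => [|j]; first exact: mulr1.
by under eq_bigr do rewrite mul1r; apply: pregoeritz_col_sum.
Qed.

Lemma coloring_goeritz_iso :
  exists g : 'cV[K]_c -> 'cV[K]_s,
    [/\ g 0 = 0, linear_on (mem (kernel K (delete_first Ct))) g &
        bijects g (kernel K (delete_first Ct)) (kernel K (delete_first Gt))].
Proof.
have [d1 [d1a d1R]] := alpha1_R1.
have labelL a (r r' : 'M[K]_(c.+1, 4)) d :
    label (a *: r + r') d = a * label r d + label r' d by rewrite /label !mxE.
apply: (linear_bijection (A := dehn_labellings D K d1)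
  (f := fun r => row' ord0 (strand_values alpha r))
  (h := fun r => row' ord0 (region_values R r))).
- split=> [|a r r' /dehnP[rP rO r1 r1'] /dehnP[r'P r'O r'1 r'1']]; apply/dehnP.
    by split=> [d|d _||]; rewrite !label0.
  split=> [d|d od||]; rewrite !labelL ?rP ?r'P ?r1 ?r'1 ?r1' ?r'1' ?mulr0 ?addr0 //.
  by rewrite addrACA -mulrDr rO // r'O //; ring.
- by move=> a r r'; apply/colP=> i; rewrite !mxE !labelE !labelL; ring.
- by move=> a r r'; apply/colP=> i; rewrite !mxE labelL.
- apply: bijects_comp coloring_drop_bij; exact: (strand_values_bij S_checkerboard).
- apply: bijects_comp goeritz_drop_bij; exact: (region_values_bij S_checkerboard).
Qed.

End Isomorphism.

Theorem theorem14 (c s : nat) (D : knot_diagram c.+1)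
    (S : {set {set dart c.+1}}) (S_checkerboard : checkerboard D S)
    (alpha : 'I_c.+1 -> {set dart c.+1})
    (alpha_strands : numbering alpha (strands D))
    (R : 'I_s.+1 -> {set dart c.+1}) (R_shaded : numbering R S)
    (alpha1_R1 : bounds (alpha ord0) (R ord0))
    (chi : {perm 'I_c.+1}) (neg : 'I_c.+1 -> bool) :
  let Ct := precoloring_mx alpha chi neg in
  let Gt := pregoeritz_mx D S R in
  let C := delete_first Ct in
  let G := delete_first Gt in
  (forall n : nat, (1 <= n)%N ->
     exists (f : 'cV[Zmod n]_c.+1 -> 'cV[Zmod n]_c)
            (g : 'cV[Zmod n]_c -> 'cV[Zmod n]_s)
            (h : 'cV[Zmod n]_s -> 'cV[Zmod n]_s.+1),
       [/\ bijects f (nontrivial_nul0 n Ct) (nontrivial_nul n C),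
           bijects g (nontrivial_nul n C) (nontrivial_nul n G),
           bijects h (nontrivial_nul n G) (nontrivial_nul0 n Gt) &
           [/\ g 0%R = 0%R,
               linear_on (mem (nul n C)) g &
               bijects g (nul n C) (nul n G)]])
  /\ (forall p : nat, prime p -> nullity 'F_p C = nullity 'F_p G).
Proof.
move=> Ct Gt C G; split=> [n _ | p p_pr]; last first.
  have [g [_ _ gB]] := coloring_goeritz_iso S_checkerboard alpha_strands R_shaded
    alpha1_R1 chi neg 'F_p.
  apply/eqP; rewrite -(eqn_exp2l _ _ (finNzRing_gt1 'F_p)) -!card_kernel.
  exact/eqP/(bijects_card gB).
have [g [g0 g_lin gB]] := coloring_goeritz_iso S_checkerboard alpha_strands R_shaded
  alpha1_R1 chi neg (Zmod n).
have fB := coloring_drop_bij S_checkerboard alpha_strands chi neg (Zmod n).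
have hB := goeritz_cons0_bij D S R (Zmod n).
have nul00 k (A : 'M[int]_k.+1) :
    nontrivial_nul0 n A = [set v in kernel0 (Zmod n) A | v != 0].
  by apply/setP=> v; rewrite !inE andbAC.
have ker0 k (A : 'M[int]_k) : 0 \in kernel (Zmod n) A by rewrite inE mulmx0.
have ker00 k (A : 'M[int]_k.+1) : 0 \in kernel0 (Zmod n) A.
  by rewrite in_set ker0 mxE /=.
exists (row' ord0), g, (@cons0 (Zmod n) s); split; last by [].
- rewrite nul00; apply: bijects_neq (ker00 _ _) fB.
  by apply/matrixP=> i j; rewrite !mxE.
- exact: bijects_neq g0 (ker0 _ _) gB.
- rewrite nul00; apply: bijects_neq (ker0 _ _) hB.
  by apply/colP=> i; rewrite !mxE; case: unlift => // j; rewrite mxE.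
Qed.
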